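(* Let $m\ge 2$, let $C_{n,m}$ be the number of comparisons made by Quickselect to find the $m$-th smallest element of a list of $n$ distinct numbers, and let $W_{n,m}=\frac{1}{n}C_{n,m}-1$. Let $D$ have the standard Dickman distribution. Then for all $n\ge m$, $$d_1(W_{n,m},D)\le \frac{(46m+8)\log(n/m)+54m+8}{n}.$$
   Context: Quickselect (to find the $m$-th smallest element of a list of $n\ge m$ distinct numbers): a pivot is chosen uniformly at random from the list and compared with each of the other $n-1$ elements; the elements smaller than the pivot form the left sublist and those larger form the right sublist. If the left sublist has size $m-1$, the pivot is the answer and the procedure stops; if it has size $\ge m$, the procedure recurses on the left sublist to find its $m$-th smallest element; otherwise (left size $L<m-1$) it recurses on the right sublist to find its $(m-L-1)$-th smallest element. All pivot choices are independent. $C_{n,m}$ denotes the total number of comparisons made. The standard Dickman distribution is the unique law of a non-negative random variable $D$ satisfying $D=_d U(D+1)$, where $U\sim\mathcal U[0,1]$ is independent of $D$. The Wasserstein distance is $d_1(X,Y)=\sup_{h\in \mathrm{Lip}_1}|Eh(X)-Eh(Y)|$, where $\mathrm{Lip}_1=\{h:|h(y)-h(x)|\le|y-x|\}$. *)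

(* Defs.v *)
From HB Require Import structures.
From mathcomp Require Import all_boot all_order all_algebra.
From mathcomp Require Import all_classical all_reals all_analysis.
Set Implicit Arguments. Unset Strict Implicit. Unset Printing Implicit Defensive.
Import Order.TTheory GRing.Theory Num.Theory.
Import numFieldNormedType.Exports.
Local Open Scope classical_set_scope.
Local Open Scope ring_scope.

(* Law (probability mass function) of the number of comparisons C_{n,m}
   made by Quickselect, computed by conditioning on the first pivot.
   The pivot has rank j.+1 (j : 'I_n, uniform), so the left sublist has
   size j; n-1 comparisons are made, then:
   - j.+1 = m : stop (0 further comparisons);
   - j >= m   : recurse on the left sublist (size j, target m);
   - j.+1 < m : recurse on the right sublist (size n - j.+1,
                 target m - j.+1).
   [fuel] only ensures termination; qs_pmf uses fuel = n, which suffices. *)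
Fixpoint qs_law (R : realType) (fuel n m : nat) : nat -> R :=
  match fuel with
  | 0 => fun k => (k == 0%N)%:R
  | f.+1 => fun k =>
      (n%:R)^-1 * \sum_(j < n)
        (if (k < n.-1)%N then 0 else
         let k' := (k - n.-1)%N in
         if j.+1 == m then (k' == 0%N)%:R
         else if (m < j.+1)%N then qs_law R f j m k'
         else qs_law R f (n - j.+1) (m - j.+1) k')
  end.

Definition qs_pmf (R : realType) (n m : nat) (k : nat) : R := qs_law R n n m k.

(* E h(W_{n,m}) with W_{n,m} = C_{n,m}/n - 1; C_{n,m} <= n(n-1)/2 < n*n,
   so the sum over k < n*n covers the whole support. *)
Definition qs_W_expect (R : realType) (n m : nat) (h : R -> R) : R :=
  \sum_(k < n * n) qs_pmf R n m k * h (k%:R / n%:R - 1).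

(* mu is the law of the standard Dickman distribution: a law on [0,oo)
   satisfying D =_d U (D + 1), U ~ Uniform[0,1] independent of D, i.e.
   mu A = int_0^1 P(u (D+1) \in A) du for every Borel set A. *)
Definition dickman_law (R : realType) (mu : probability R R) : Prop :=
  mu [set` `]-oo, 0%R[] = 0%E /\
  forall A : set R, measurable A ->
    mu A = (\int[@lebesgue_measure R]_(u in [set` `[0%R, 1%R]])
              mu ((fun x : R => (u * (x + 1))%R) @^-1` A))%E.

Definition Lip1 (R : realType) : set (R -> R) :=
  [set h | forall x y : R, `|h y - h x| <= `|y - x|].

Definition d1_qs_dickman (R : realType) (n m : nat) (mu : probability R R)
  : \bar R :=
  ereal_sup [set (`|qs_W_expect n m h - Rintegral mu setT h|)%:E
            | h in @Lip1 R].

(* Main.v *)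
(** Couple the first pivot with the uniform variable of the fixed-point equation
    D = U (D + 1): the pivot of rank j+1 corresponds to U in [j/n, (j+1)/n].
    The expectation of h(u (D + 1)) is Lipschitz in u, so replacing U by j/n
    costs O(1/n).  If j >= m, Quickselect recurses on the left sublist and
    C_{j,m}/n = (j/n) (W_{j,m} + 1) is to be compared with (j/n) (D + 1), so the
    distance is scaled by j/n; the m values j < m have total probability m/n and
    contribute O(m/n), since E C_{n,m} <= 4n.  Thus b_n := n d_1(W_{n,m}, D)
    satisfies b_n <= 7m + 7 + (1/n) sum_{m <= j < n} b_j, whence
    b_n <= (7m + 7) (1 + log(n/m)).

    That D has a finite mean must be extracted from the fixed-point equation: if
    E min(w|D|, K) <= e + A w for all w >= 0, then the same holds with (A + 1)/2
    instead of A, hence with A = 1; now let e -> 0 and K -> oo. *)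
Require Import Defs.
From HB Require Import structures.
From mathcomp Require Import all_boot all_order all_algebra.
From mathcomp Require Import all_classical all_reals all_analysis.
From mathcomp Require Import ring lra zify measurable_realfun.
Import Order.TTheory GRing.Theory Num.Theory.
Import numFieldNormedType.Exports.
Set Implicit Arguments.
Unset Strict Implicit.
Unset Printing Implicit Defensive.
Local Open Scope classical_set_scope.
Local Open Scope ring_scope.

(** * The Dickman fixed-point equation *)

Lemma measurable_dickman_map {R : realType} :
  measurable_fun [set: R * R] (fun z => z.1 * (z.2 + 1)).
Proof.
apply: measurable_funM => //.
by apply: measurable_funD => //.
Qed.

(** The fixed-point equation says that [mu] is the image of the product of the uniform law and [mu]
    under $(u,x) \mapsto u(x+1)$. Tonelli then gives the formula, hence the restriction to $f \ge
    0$. *)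
Lemma ge0_integral_dickman (R : realType) (mu : probability R R)
    (f : R -> \bar R) :
  dickman_law mu -> measurable_fun setT f -> (forall x, 0 <= f x)%E ->
  (\int[mu]_x f x =
   \int[lebesgue_measure]_(u in `[0%R, 1%R]) \int[mu]_x f (u * (x + 1))%R)%E.
Proof.
move=> [_ hmu] mf f0.
have mphi := @measurable_dickman_map R.
pose nu := (uniform_prob (@ltr01 R) \x mu)%E.
transitivity (\int[pushforward nu (fun z : R * R => (z.1 * (z.2 + 1))%R)]_x f x)%E.
  apply: eq_measure_integral => A mA _.
  rewrite [LHS]hmu// /=. rewrite /pushforward /nu /product_measure1.
  rewrite [RHS]integral_uniform//=.
  - rewrite subr0 invr1 mul1e; apply: eq_integral => u _; congr (mu _).
    by apply/seteqP; split => x; rewrite /xsection/= ?inE//= => /set_mem.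
  - apply: measurable_fun_xsection.
    by rewrite -[X in measurable X]setTI; exact: mphi.
rewrite ge0_integral_pushforward//=; rewrite preimage_setT /nu.
rewrite fubini_tonelli1//=; last exact: measurableT_comp.
rewrite integral_uniform//.
- by rewrite subr0 invr1 mul1e.
- apply: measurable_fun_fubini_tonelli_F => //; exact: measurableT_comp.
- by move=> x; exact: integral_ge0.
Qed.

Lemma measurable_fun_integral_dickman (R : realType) (mu : probability R R)
    (f : R -> \bar R) D :
  measurable_fun setT f -> (forall x, 0 <= f x)%E ->
  measurable_fun D (fun u : R => \int[mu]_x f (u * (x + 1))%R)%E.
Proof.
move=> mf f0; apply: measurable_funTS.
apply: (@measurable_fun_fubini_tonelli_F _ _ _ _ _ mu
  (fun z : R * R => f (z.1 * (z.2 + 1)))) => //.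
exact: (measurableT_comp mf measurable_dickman_map).
Qed.

(** * Finite mean of the Dickman law *)

Lemma integral_affine01 (R : realType) (a b : R) :
  (\int[lebesgue_measure]_(u in `[0%R, 1%R]) (a + b * u)%:E = (a + b / 2)%:E)%E.
Proof.
pose F (u : R) := a * u + b / 2 * (u * u).
have dF (u : R) : is_derive u (1 : R) F (a + b * u).
  rewrite /F; apply: is_derive_eq; rewrite /GRing.scale /= ; lra.
have cF (u : R) : {for u, continuous F}.
  by apply/differentiable_continuous/derivable1_diffP; exact: ex_derive.
rewrite (@continuous_FTC2 _ _ F) //.
- by rewrite /F -EFinB; congr EFin; lra.
- apply: continuous_subspaceT => u.
  by apply: cvgD; [exact: cvg_cst|apply: cvgM; [exact: cvg_cst|exact: cvg_id]].
- split.
  + move=> u _; exact: ex_derive.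
  + exact/cvg_at_right_filter/cF.
  + exact/cvg_at_left_filter/cF.
- by move=> u _; rewrite derive1E derive_val.
Qed.

(** Truncation at [K] is compatible with adding a constant $b \ge 0$: $\min(a+b,K) \le
    \min(a,K)+b$. *)
Lemma minr_dickman (R : realType) (K v u x : R) : 0 <= u -> 0 <= v ->
  Num.min (v * `|u * (x + 1)|) K <= Num.min (v * u * `|x|) K + v * u.
Proof.
move=> u0 v0.
have h : v * `|u * (x + 1)| <= v * u * `|x| + v * u.
  rewrite normrM (ger0_norm u0) mulrA -[X in _ <= _ + X]mulr1 -mulrDr.
  by apply: ler_wpM2l; rewrite ?mulr_ge0// (le_trans (ler_normD _ _))// normr1.
rewrite -lerBlDr le_min; apply/andP; split.
  by rewrite lerBlDr (le_trans _ h)// ge_min lexx.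
have := mulr_ge0 v0 u0.
have : Num.min (v * `|u * (x + 1)|) K <= K by rewrite ge_min lexx orbT.
by lra.
Qed.

Lemma measurable_minnorm (R : realType) (w K : R) :
  measurable_fun [set: R] (fun x : R => Num.min (w * `|x|) K).
Proof.
apply: measurable_minr => //; apply: measurable_funM => //.
Qed.

(** Given $U=u$, the hypothesis at $wu$ bounds the truncated mean by $e + Awu + wu$. Averaging over
    $u$ halves the slope $A+1$. *)
Lemma dickman_affine_step (R : realType) (mu : probability R R) (K e A : R) :
  dickman_law mu -> 0 <= K -> 0 <= e -> 0 <= A ->
  (forall w : R, 0 <= w ->
    (\int[mu]_x (Num.min (w * `|x|) K)%:E <= (e + A * w)%:E)%E) ->
  (forall w : R, 0 <= w ->
    (\int[mu]_x (Num.min (w * `|x|) K)%:E <= (e + (A + 1) / 2 * w)%:E)%E).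
Proof.
move=> hmu K0 e0 A0 hA w w0.
have m0 v x : 0 <= v -> 0 <= Num.min (v * `|(x : R)|) K.
  by move=> v0; rewrite le_min K0 mulr_ge0.
rewrite (ge0_integral_dickman hmu); last 2 first.
- by apply/measurable_EFinP; exact: measurable_minnorm.
- by move=> x; rewrite lee_fin m0.
apply: (@le_trans _ _ (\int[lebesgue_measure]_(u in `[0%R, 1%R])
    (e + ((A + 1) * w) * u)%:E)%E); last first.
  by rewrite integral_affine01 lee_fin; lra.
apply: ge0_le_integral => //=.
- by move=> u _; apply: integral_ge0 => x _; rewrite lee_fin m0.
- apply: (@measurable_fun_integral_dickman _ _ (fun y => (Num.min (w * `|y|) K)%:E)).
    by apply/measurable_EFinP; exact: measurable_minnorm.
  by move=> x; rewrite lee_fin m0.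
- apply/measurable_EFinP; apply: measurable_funD => //.
- move=> u /=; rewrite in_itv/= => /andP[u0 _].
  apply: (@le_trans _ _ (\int[mu]_x ((Num.min (w * u * `|x|) K)%:E + (w * u)%:E))%E).
    apply: ge0_le_integral => //=.
    + by move=> x _; rewrite lee_fin m0.
    + apply/measurable_EFinP; apply: measurable_minr => //.
      apply: measurable_funM => //; apply: measurableT_comp => //.
      by apply: measurable_funM => //; exact: measurable_funD.
    + apply: emeasurable_funD => //.
      by apply/measurable_EFinP; exact: measurable_minnorm.
    + by move=> x _; rewrite -EFinD lee_fin minr_dickman.
  rewrite ge0_integralD//=.
  + rewrite integral_cst//= probability_setT mule1.
    have := hA (w * u) (mulr_ge0 w0 u0).
    move=> /(leeD2r (w * u)%:E) /le_trans; apply.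
    by rewrite -EFinD lee_fin; lra.
  + by move=> x _; rewrite lee_fin m0 ?mulr_ge0.
  + by apply/measurable_EFinP; exact: measurable_minnorm.
  + by move=> x _; rewrite lee_fin mulr_ge0.
Qed.

(** Truncation makes dominated convergence available before the mean is known to be finite: the
    integral tends to 0 with $w$, so it is at most $e$ for small $w$. For larger $w$ the trivial
    bound $K$ is linear in $w$ up to a constant. *)
Lemma dickman_affine_start (R : realType) (mu : probability R R) (K e : R) :
  0 <= K -> 0 < e ->
  exists2 A : R, 0 <= A & forall w : R, 0 <= w ->
    (\int[mu]_x (Num.min (w * `|x|) K)%:E <= (e + A * w)%:E)%E.
Proof.
move=> K0 e0.
have m0 (v x : R) : 0 <= v -> 0 <= Num.min (v * `|x|) K.
  by move=> v0; rewrite le_min K0 mulr_ge0.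
pose f (n : nat) (x : R) := (Num.min (n.+1%:R^-1 * `|x|) K)%:E.
have mf n : measurable_fun setT (f n).
  by apply/measurable_EFinP; exact: measurable_minnorm.
have f0 : {ae mu, forall x, setT x -> f ^~ x @ \oo --> cst 0%E x}.
  apply: aeW => x _; apply: cvg_EFin; first exact: nearW.
  apply: (@squeeze_cvgr _ _ _ _ (fun=> 0) (fun n => n.+1%:R^-1 * `|x|)).
  - by apply: nearW => n /=; rewrite m0//= ge_min lexx.
  - exact: cvg_cst.
  - rewrite -[X in _ --> X](mul0r `|x|); apply: cvgM; last exact: cvg_cst.
    exact: cvg_harmonic.
have fK : {ae mu, forall x n, setT x -> (`|f n x| <= cst K%:E x)%E}.
  by apply: aeW => x n _ /=; rewrite lee_fin ger0_norm ?m0//= ge_min lexx orbT.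
have [_ _] := @dominated_convergence _ _ R mu setT measurableT f (cst 0%E) (cst K%:E)
  mf (measurable_cst _) f0 (finite_measure_integrable_cst mu K measurableT) fK.
rewrite integral_cst// mul0e => /fine_cvgP[fin /cvgrPdist_le/(_ _ e0)[N1 _ hN1]].
case: fin => N2 _ hN2.
pose N := maxn N1 N2.
have hN : (\int[mu]_x f N x <= e%:E)%E.
  have := fineK (hN2 N (leq_maxr _ _)); rewrite /= => <-; rewrite lee_fin.
  have := hN1 N (leq_maxl _ _); rewrite /= sub0r normrN; exact/le_trans/ler_norm.
(* This slope makes $Aw \ge K$ as soon as $w > 1/(N+1)$. *)
exists (K * N.+1%:R); first by rewrite mulr_ge0.
move=> w w0; have [wN|wN] := leP w N.+1%:R^-1.
  apply: (@le_trans _ _ (\int[mu]_x f N x)%E).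
    apply: ge0_le_integral => //=.
    + by move=> x _; rewrite lee_fin m0.
    + by apply/measurable_EFinP; exact: measurable_minnorm.
    + move=> x _; rewrite lee_fin le_min !ge_min lexx orbT andbT.
      by rewrite ler_wpM2r.
  by rewrite (le_trans hN)// lee_fin lerDl !mulr_ge0.
apply: (@le_trans _ _ (\int[mu]_x (cst K%:E x))%E).
  apply: ge0_le_integral => //=.
  + by move=> x _; rewrite lee_fin m0.
  + by apply/measurable_EFinP; exact: measurable_minnorm.
  + by move=> x _; rewrite lee_fin ge_min lexx orbT.
rewrite integral_cst// [X in (_ * X)%E]probability_setT mule1 lee_fin.
have : 1 <= N.+1%:R * w.
  by rewrite -ler_pdivrMl ?ltr0n// mulr1 ltW.
nra.
Qed.

Lemma dickman_truncated_mean (R : realType) (mu : probability R R) (K : R) :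
  dickman_law mu -> 0 <= K -> (\int[mu]_x (Num.min `|x| K)%:E <= 1)%E.
Proof.
move=> hmu K0; apply/lee_addgt0Pr => e e0.
have e20 : 0 < e / 2 by rewrite divr_gt0.
have [A A0 hA] := dickman_affine_start mu K0 e20.
(* The slope map $A \mapsto (A+1)/2$ has fixed point 1 and halves the distance to it. The iteration
   starts from the weaker slope $1+A$. *)
have hN (N : nat) (w : R) : 0 <= w ->
    (\int[mu]_x (Num.min (w * `|x|) K)%:E <= (e / 2 + (1 + A / 2 ^+ N) * w)%:E)%E.
  elim: N w => [|N IH] w w0.
    by rewrite (le_trans (hA w w0))// lee_fin expr0; nra.
  have -> : 1 + A / 2 ^+ N.+1 = ((1 + A / 2 ^+ N) + 1) / 2.
    by rewrite exprS invfM; lra.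
  apply: (dickman_affine_step (K := K)) => //; first exact: ltW.
  by rewrite addr_ge0// divr_ge0// exprn_ge0.
have [N AN] : exists N : nat, A / 2 ^+ N <= e / 2.
  exists (Num.bound (A / (e / 2))).
  rewrite ler_pdivrMr ?exprn_gt0// -ler_pdivrMl// mulrC.
  have := archi_boundP (divr_ge0 A0 (ltW e20)) => /ltW/le_trans; apply.
  by rewrite -natrX ler_nat ltnW// ltn_expl.
have := hN N 1 ler01; under eq_integral do rewrite mul1r.
by move=> /le_trans; apply; rewrite -EFinD lee_fin; lra.
Qed.

Lemma dickman_mean (R : realType) (mu : probability R R) :
  dickman_law mu -> (\int[mu]_x `|x|%:E <= 1)%E.
Proof.
move=> hmu.
pose f (n : nat) (x : R) := (Num.min `|x| n%:R)%:E.
have nd x (a b : nat) : (a <= b)%N -> (f a x <= f b x)%E.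
  move=> ab; rewrite lee_fin le_min !ge_min lexx/=.
  by rewrite [(a%:R <= _)]ler_nat ab orbT.
have -> : (\int[mu]_x `|x|%:E = \int[mu]_x limn (f ^~ x))%E.
  apply: eq_integral => x _; apply/esym/cvg_lim => //.
  apply: cvg_EFin; first exact: nearW.
  apply: cvg_near_cst.
  exists (Num.bound `|x|) => // n /= hn.
  rewrite min_l//; apply/ltW; apply: lt_le_trans (archi_boundP (normr_ge0 x)) _.
  by rewrite ler_nat.
rewrite monotone_convergence//.
- apply: lime_le.
    apply: ereal_nondecreasing_is_cvgn => a b ab; apply: ge0_le_integral => //=.
    + by move=> x _; rewrite lee_fin le_min normr_ge0 ler0n.
    + by apply/measurable_EFinP; apply: measurable_minr.
    + by apply/measurable_EFinP; apply: measurable_minr.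
    + by move=> x _; exact: nd.
  by apply: nearW => n; exact: dickman_truncated_mean.
- by move=> n; apply/measurable_EFinP; apply: measurable_minr.
- by move=> n x _; rewrite lee_fin le_min normr_ge0 ler0n.
- by move=> x _ a b ab; exact: nd.
Qed.

(** * Riemann sums *)

Section riemann.
Variables (R : realType) (L : R) (G : R -> R).
Hypothesis LG : forall x y, `|G x - G y| <= L * `|x - y|.
Local Notation leb := (@lebesgue_measure R).

Lemma lipschitz_cst_ge0 : 0 <= L.
Proof.
have := LG 1 0; rewrite subr0 normr1 mulr1; exact: le_trans.
Qed.

Lemma lipschitz_continuous : continuous G.
Proof.
move=> x; apply/cvgrPdist_le => /= e e0.
have L1 : 0 < L + 1 by rewrite ltr_pwDr// lipschitz_cst_ge0.
apply/nbhs_ballP; exists (e / (L + 1)); rewrite /= ?divr_gt0// => y /= xy.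
rewrite (le_trans (LG _ _))//.
apply: (@le_trans _ _ ((L + 1) * `|x - y|)); first by rewrite ler_wpM2r// lerDl.
by rewrite -ler_pdivlMl// mulrC ltW.
Qed.

Lemma lipschitz_integrable_itv (a b : R) : leb.-integrable `[a, b] (EFin \o G).
Proof.
apply: continuous_compact_integrable; first exact: segment_compact.
exact/continuous_subspaceT/lipschitz_continuous.
Qed.

(** Replacing [G] by its value at the left end costs at most $L(b-a)$ at each point of the
    interval. *)
Lemma lipschitz_Rintegral_itv (a b : R) : a <= b ->
  `|\int[leb]_(x in `]a, b]) G x - (b - a) * G a| <= L * (b - a) ^+ 2.
Proof.
move=> ab.
have iG : leb.-integrable `]a, b] (EFin \o G).
  apply: integrableS (lipschitz_integrable_itv a b) => //.
  exact: subset_itv_oc_cc.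
have fm : fine (leb `]a, b]%classic) = b - a.
  rewrite lebesgue_measure_itv/= lte_fin.
  by move: ab; rewrite le_eqVlt => /predU1P[->|->]//; rewrite ltxx subrr.
have ic (c : R) : leb.-integrable `]a, b] (EFin \o cst c).
  apply: (@integrableS _ _ _ leb `[a, b]) => //; first exact: subset_itv_oc_cc.
  apply: continuous_compact_integrable; first exact: segment_compact.
  exact/continuous_subspaceT/cst_continuous.
have <- : \int[leb]_(x in `]a, b]) (cst (G a) x) = (b - a) * G a.
  by rewrite Rintegral_cst// fm mulrC.
rewrite -RintegralB//.
have iB : leb.-integrable `]a, b] (EFin \o (fun x => G x - cst (G a) x)).
  exact: (integrableB _ iG (ic _)).
apply: (le_trans (le_normr_Rintegral _ iB)) => //.
have <- : \int[leb]_(x in `]a, b]) (cst (L * (b - a)) x) = L * (b - a) ^+ 2.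
  by rewrite Rintegral_cst// fm -mulrA.
apply: le_Rintegral => //.
- exact: (integrable_norm iB).
- move=> x /=; rewrite in_itv/= => /andP[ax xb].
  rewrite (le_trans (LG _ _))// ler_wpM2l ?lipschitz_cst_ge0//.
  by rewrite ger0_norm ?lerD2r// subr_ge0 ltW.
Qed.

Lemma lipschitz_riemann_sum (n : nat) : (0 < n)%N ->
  `|\int[leb]_(x in `[0, 1]) G x - n%:R^-1 * \sum_(j < n) G (j%:R / n%:R)|
    <= L / n%:R.
Proof.
move=> n0; pose d : R := n%:R^-1.
have d0 : 0 <= d by rewrite invr_ge0.
(* The mesh [d] stays fixed while the number [k] of cells grows; each cell costs $L d^2$. *)
suff H k : `|\int[leb]_(x in `[0, k%:R * d]) G x - d * \sum_(j < k) G (j%:R * d)|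
    <= k%:R * (L * d ^+ 2).
  have nd : n%:R * d = 1 by rewrite mulfV// pnatr_eq0 -lt0n.
  have := H n; rewrite nd expr2 mulrCA (mulrA n%:R) nd mul1r; exact.
elim: k => [|k IH].
  by rewrite !mul0r big_ord0 mulr0 subr0 set_itv1 Rintegral_set1 normr0.
have kk : k%:R * d <= k.+1%:R * d by rewrite ler_wpM2r// ler_nat.
have := @Rintegral_itvB _ G (BLeft 0) (BRight (k.+1%:R * d)) (k%:R * d)
  (lipschitz_integrable_itv _ _).
rewrite !bnd_simp mulr_ge0// => /(_ isT kk) hB.
have := lipschitz_Rintegral_itv kk; rewrite -hB.
have -> : k.+1%:R * d - k%:R * d = d by rewrite -natr1; ring.
rewrite big_ord_recr/= mulrDr.
have -> : k.+1%:R * (L * d ^+ 2) = k%:R * (L * d ^+ 2) + L * d ^+ 2.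
  by rewrite -natr1; ring.
set I := Rintegral _ _ _ in IH *; set I' := Rintegral _ _ _.
set S := d * _ in IH *; set g := d * _.
move=> h; have -> : I' - (S + g) = (I - S) + (I' - I - g) by ring.
by rewrite (le_trans (ler_normD _ _))// lerD.
Qed.
End riemann.

(** * Lipschitz functions integrated against the Dickman law *)

Section lipschitz_dickman.
Variables (R : realType) (mu : probability R R).
Hypothesis hmu : dickman_law mu.

(** The weight $|x|+1$ dominates Lipschitz functions up to a constant, and also measures the effect
    of $u$ in $u(x+1)$. *)
Lemma dickman_integrable_abs :
  mu.-integrable setT (EFin \o (fun x : R => `|x| + 1)).
Proof.
apply: (@integrableD _ _ _ mu setT measurableT (EFin \o (fun x => `|x|))
  (EFin \o cst 1)); last exact: finite_measure_integrable_cst.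
apply/integrableP; split; first exact/measurable_EFinP.
rewrite (le_lt_trans _ (ltry 1))// (le_trans _ (dickman_mean hmu))//.
by under eq_integral do rewrite /= normr_id.
Qed.

Lemma dickman_Rintegral_abs : \int[mu]_x (`|x| + 1) <= 2.
Proof.
have h : (\int[mu]_x (`|x| + 1)%:E <= 2%:E)%E.
  under eq_integral do rewrite EFinD.
  rewrite ge0_integralD//=.
  - rewrite integral_cst// [X in (_ * X)%E]probability_setT mule1.
    apply: (@le_trans _ _ (1 + 1)%E); first by apply: leeD2r; exact: dickman_mean.
    by rewrite -EFinD lee_fin; lra.
  - exact/measurable_EFinP.
have fin : (\int[mu]_x (`|x| + 1)%:E)%E \is a fin_num.
  by apply: integrable_fin_num => //; exact: dickman_integrable_abs.
by rewrite /Rintegral -lee_fin fineK.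
Qed.

Lemma dickman_lipschitz_integrable (L : R) (h : R -> R) :
  (forall x y, `|h x - h y| <= L * `|x - y|) ->
  mu.-integrable setT (EFin \o h).
Proof.
move=> Lh; have L0 := lipschitz_cst_ge0 Lh.
have mh : measurable_fun setT h.
  apply: continuous_measurable_fun; exact: lipschitz_continuous Lh.
apply: (@le_integrable _ _ _ mu setT measurableT _
  (EFin \o (fun x => (L + `|h 0|) * (`|x| + 1)))).
- by apply/measurable_EFinP.
- move=> x _ /=; rewrite lee_fin [leRHS]ger0_norm; last by rewrite mulr_ge0// addr_ge0.
  have := Lh x 0; rewrite subr0 => hx.
  have := ler_normD (h x - h 0) (h 0); rewrite subrK => hx'.
  have := mulr_ge0 (normr_ge0 (h 0)) (normr_ge0 x).
  rewrite (le_trans hx')//; move: hx (normr_ge0 (h 0)) (normr_ge0 x); nra.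
- exact: (integrableZl measurableT (L + `|h 0|) dickman_integrable_abs).
Qed.

Lemma dickman_dist_Rintegral (c : R) (f g : R -> R) :
  mu.-integrable setT (EFin \o f) -> mu.-integrable setT (EFin \o g) ->
  (forall x, `|f x - g x| <= c * (`|x| + 1)) ->
  `|\int[mu]_x f x - \int[mu]_x g x| <= 2 * c.
Proof.
move=> fi gi fg.
have c0 : 0 <= c.
  by have := fg 0; rewrite normr0 add0r mulr1; exact: le_trans.
rewrite -RintegralB//.
have iB : mu.-integrable setT (EFin \o (fun x => f x - g x)).
  exact: (integrableB _ fi gi).
rewrite (le_trans (le_normr_Rintegral _ iB))//.
apply: (@le_trans _ _ (\int[mu]_x (c * (`|x| + 1)))).
  apply: le_Rintegral => //.
  - exact: (integrable_norm iB).
  - exact: (integrableZl measurableT c dickman_integrable_abs).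
rewrite RintegralZl//; last exact: dickman_integrable_abs.
by rewrite mulrC ler_wpM2r// dickman_Rintegral_abs.
Qed.

(** The conditional expectation of $h(U(D+1))$ given $U=u$. *)
Definition dickman_scale (h : R -> R) (u : R) := \int[mu]_x h (u * (x + 1)).

Lemma lipschitz_scale (L : R) (h : R -> R) (u : R) :
  (forall x y, `|h x - h y| <= L * `|x - y|) ->
  forall x y, `|h (u * (x + 1)) - h (u * (y + 1))| <= (L * `|u|) * `|x - y|.
Proof.
move=> Lh x y; rewrite (le_trans (Lh _ _))//.
rewrite -mulrA -normrM.
by have -> : u * (x + 1) - u * (y + 1) = u * (x - y) by ring.
Qed.

Lemma dickman_scale_integrable (L : R) (h : R -> R) (u : R) :
  (forall x y, `|h x - h y| <= L * `|x - y|) ->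
  mu.-integrable setT (EFin \o (fun x => h (u * (x + 1)))).
Proof.
by move=> Lh; apply: dickman_lipschitz_integrable (lipschitz_scale u Lh).
Qed.

Lemma dickman_scale_lipschitz (L : R) (h : R -> R) :
  (forall x y, `|h x - h y| <= L * `|x - y|) ->
  forall u v, `|dickman_scale h u - dickman_scale h v| <= (2 * L) * `|u - v|.
Proof.
move=> Lh u v; rewrite -mulrA; apply: dickman_dist_Rintegral.
- exact: dickman_scale_integrable Lh.
- exact: dickman_scale_integrable Lh.
- move=> x; rewrite (le_trans (Lh _ _))// -mulrBl normrM mulrA.
  rewrite ler_wpM2l ?mulr_ge0 ?(lipschitz_cst_ge0 Lh)//.
  by rewrite (le_trans (ler_normD _ _))// normr1.
Qed.

Lemma dickman_riemann_sum_ge0 (L : R) (h : R -> R) (n : nat) :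
  (forall x y, `|h x - h y| <= L * `|x - y|) -> (forall x, 0 <= h x) ->
  (0 < n)%N ->
  `|\int[mu]_x h x - n%:R^-1 * \sum_(j < n) dickman_scale h (j%:R / n%:R)|
    <= (2 * L) / n%:R.
Proof.
move=> Lh h0 n0.
have -> : \int[mu]_x h x =
    \int[lebesgue_measure]_(u in `[0, 1]) dickman_scale h u.
  rewrite /Rintegral (ge0_integral_dickman hmu).
  - congr fine; apply: eq_integral => u _; rewrite fineK//.
    by apply: integrable_fin_num => //; exact: dickman_scale_integrable Lh.
  - apply/measurable_EFinP; apply: continuous_measurable_fun.
    exact: lipschitz_continuous Lh.
  - by move=> x; rewrite lee_fin.
apply: lipschitz_riemann_sum => //; exact: dickman_scale_lipschitz.
Qed.

Lemma dickman_riemann_sum (L : R) (h : R -> R) (n : nat) :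
  (forall x y, `|h x - h y| <= L * `|x - y|) -> (0 < n)%N ->
  `|\int[mu]_x h x - n%:R^-1 * \sum_(j < n) dickman_scale h (j%:R / n%:R)|
    <= (6 * L) / n%:R.
Proof.
move=> Lh n0; have L0 := lipschitz_cst_ge0 Lh.
(* h is a difference of nonnegative functions: only those are covered by
   [ge0_integral_dickman]. *)
pose q (x : R) := L * `|x| + `|h 0|; pose p (x : R) := h x + q x.
have Lq (x y : R) : `|q x - q y| <= L * `|x - y|.
  have -> : q x - q y = L * (`|x| - `|y|) by rewrite /q; ring.
  by rewrite normrM (ger0_norm L0) ler_wpM2l// ler_dist_dist.
have Lp x y : `|p x - p y| <= (2 * L) * `|x - y|.
  have -> : p x - p y = (h x - h y) + (q x - q y) by rewrite /p; ring.
  rewrite (le_trans (ler_normD _ _))//.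
  by have := Lh x y; have := Lq x y; lra.
have q0 x : 0 <= q x by rewrite addr_ge0// mulr_ge0.
have p0 x : 0 <= p x.
  have := Lh 0 x; rewrite sub0r normrN => /(le_trans (ler_norm _)).
  by rewrite /p /q; have := ler_norm (- h 0); rewrite normrN; lra.
have hE : h = (fun x => p x - q x).
  by apply/funext => x; rewrite /p addrK.
have -> : \int[mu]_x h x = \int[mu]_x p x - \int[mu]_x q x.
  rewrite hE RintegralB//; [exact: (dickman_lipschitz_integrable Lp)|].
  exact: (dickman_lipschitz_integrable Lq).
have Gh u : dickman_scale h u = dickman_scale p u - dickman_scale q u.
  rewrite /dickman_scale hE RintegralB//.
    exact: (dickman_scale_integrable u Lp).
  exact: (dickman_scale_integrable u Lq).
under eq_bigr do rewrite Gh.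
rewrite sumrB mulrBr.
have := dickman_riemann_sum_ge0 Lp p0 n0.
have := dickman_riemann_sum_ge0 Lq q0 n0.
set P := Rintegral _ _ p; set Q := Rintegral _ _ q.
set SP := _ * \sum_(j < n) dickman_scale p _.
set SQ := _ * \sum_(j < n) dickman_scale q _.
move=> hQ hP; have -> : P - Q - (SP - SQ) = (P - SP) - (Q - SQ) by ring.
rewrite (le_trans (ler_normB _ _))// (le_trans (lerD hP hQ))//.
(* [p] is $2L$-Lipschitz and contributes $4L$; [q] is $L$-Lipschitz and contributes $2L$. *)
by rewrite -mulrDl ler_wpM2r// ?invr_ge0//; lra.
Qed.
End lipschitz_dickman.

(** * Expectations under the law of Quickselect *)

Lemma sum_shift (R : realType) (a phi : nat -> R) (c N : nat) : (c <= N)%N ->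
  \sum_(k < N) (if (k < c)%N then 0 else a (k - c)%N) * phi k =
  \sum_(k < N - c) a k * phi (k + c)%N.
Proof.
move=> cN.
rewrite -(big_mkord predT (fun k => (if (k < c)%N then 0 else a (k - c)%N) * phi k)).
rewrite (big_cat_nat (n := c))//= big_nat_cond big1 ?add0r; last first.
  by move=> k; rewrite andbT => /andP[_ ->]; rewrite mul0r.
rewrite -{1}[c]add0n big_addn big_mkord; apply: eq_bigr => k _.
by rewrite ltnNge leq_addl/= addnK.
Qed.

(* The expectation of [phi] under [qs_law], as an operator acting on [phi]
   directly, so that no summation range has to be tracked. *)
Fixpoint qs_expect (R : realType) (f n m : nat) (phi : nat -> R) : R :=
  match f with
  | 0 => phi 0%N
  | f.+1 =>
      n%:R^-1 * \sum_(j < n)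
        (if j.+1 == m then phi n.-1
         else if (m < j.+1)%N then qs_expect f j m (fun k => phi (k + n.-1)%N)
         else qs_expect f (n - j.+1) (m - j.+1) (fun k => phi (k + n.-1)%N))
  end.

(** [N] is left free because the first $n-1$ comparisons shorten the range to $N-(n-1)$, which is
    only known to be at least the square of the sublist size. *)
Lemma qs_lawE (R : realType) (f n m N : nat) (phi : nat -> R) :
  (n <= f)%N -> (0 < m <= n)%N -> (n * n <= N)%N ->
  \sum_(k < N) qs_law R f n m k * phi k = qs_expect f n m phi.
Proof.
elim: f n m N phi => [|f IH] n m N phi nf /andP[m0 mn] nN; first by lia.
rewrite /=.
under eq_bigr do rewrite -mulrA mulr_suml.
rewrite -mulr_sumr exchange_big/=; congr (_ * _); apply: eq_bigr => j _.
have jn := ltn_ord j.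
rewrite (sum_shift (fun k' => if j.+1 == m then (k' == 0%N)%:R
         else if (m < j.+1)%N then qs_law R f j m k'
         else qs_law R f (n - j.+1) (m - j.+1) k')); last by nia.
have [jm|jm] := eqVneq.
  have N0 : (0 < N - n.-1)%N by nia.
  case: (N - n.-1)%N N0 => // N' _.
  rewrite big_ord_recl big1 => [|i _]; last by rewrite /= mul0r.
  by rewrite /= mul1r addr0 add0n.
case: ifPn => mj; apply: IH; nia.
Qed.

Lemma qs_expect_le (R : realType) (f n m : nat) (phi psi : nat -> R) :
  (forall k, phi k <= psi k) -> qs_expect f n m phi <= qs_expect f n m psi.
Proof.
elim: f n m phi psi => [|f IH] n m phi psi h //=.
rewrite ler_wpM2l ?invr_ge0//; apply: ler_sum => j _.
by case: ifP => // _; case: ifP => _; apply: IH.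
Qed.

Lemma qs_expect_lin (R : realType) (f n m : nat) (a b : R) (phi psi : nat -> R) :
  qs_expect f n m (fun k => a * phi k + b * psi k) =
  a * qs_expect f n m phi + b * qs_expect f n m psi.
Proof.
elim: f n m phi psi => [|f IH] n m phi psi //=.
rewrite !(mulrCA _ n%:R^-1) -mulrDr; congr (_ * _).
rewrite !mulr_sumr -big_split/=; apply: eq_bigr => j _.
by case: ifP => // _; case: ifP => _; rewrite -IH.
Qed.

(** The total mass is 1. A target inside the list keeps all lists of the recursion non-empty, so
    that $n^{-1}$ is never the default value $0^{-1}=0$. *)
Lemma qs_expect_cst (R : realType) (f n m : nat) (c : R) :
  (n <= f)%N -> (0 < m <= n)%N -> qs_expect f n m (fun=> c) = c.
Proof.
elim: f n m => [|f IH] n m nf mn //=.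
rewrite (eq_bigr (fun=> c)) => [|j _].
  rewrite sumr_const card_ord -[c *+ n]mulr_natl mulrA mulVf ?mul1r// pnatr_eq0; lia.
have jn := ltn_ord j; have [//|jm] := eqVneq.
by case: ifPn => mj; apply: IH; lia.
Qed.

(** The triangle inequality for a positive linear functional. *)
Lemma qs_expect_dist (R : realType) (f n m : nat) (phi psi chi : nat -> R) :
  (forall k, `|phi k - psi k| <= chi k) ->
  `|qs_expect f n m phi - qs_expect f n m psi| <= qs_expect f n m chi.
Proof.
move=> h.
have -> : qs_expect f n m phi - qs_expect f n m psi =
    qs_expect f n m (fun k => 1 * phi k + (-1) * psi k).
  by rewrite qs_expect_lin mul1r mulN1r.
rewrite ler_norml; apply/andP; split.
  have -> : - qs_expect f n m chi =
      qs_expect f n m (fun k => (-1) * chi k + 0 * chi k).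
    by rewrite qs_expect_lin; ring.
  apply: qs_expect_le => k; have := h k; rewrite ler_norml => /andP[]; lra.
by apply: qs_expect_le => k; have := h k; rewrite ler_norml => /andP[]; lra.
Qed.

(** Bounds the total length of the longer sublists. From $n$ to $n+2$ the two extreme ranks add
    $n+1$ each and every inner term grows by 1, so the left side grows by $12n+8$ and the right side
    by $12n+12$. *)
Lemma sum_maxn_le (n : nat) : (4 * \sum_(j < n) maxn j (n.-1 - j) <= 3 * n ^ 2)%N.
Proof.
elim/ltn_ind: n => -[|[|n]] IH; first by rewrite big_ord0.
  by rewrite big_ord1.
rewrite big_ord_recl big_ord_recr/=.
have -> : (\sum_(i < n) maxn (bump 0 i) (n.+1 - bump 0 i) =
    \sum_(i < n) (maxn i (n.-1 - i) + 1))%N.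
  by apply: eq_bigr => i _; have := ltn_ord i; rewrite /bump/=; lia.
rewrite big_split/= sum_nat_const card_ord /bump /=.
have := IH n (ltnW (ltnSn _)).
by rewrite max0n subn0 add1n subnn maxn0 -!mulnn; set S := (\sum_(j < n) _)%N; nia.
Qed.

(** Whichever sublist is entered, it is no longer than the longer one, so the induction gives at
    most $(n-1)+3n \le 4n$, uniformly in [m]. *)
Lemma qs_expect_mean (R : realType) (f n m : nat) :
  (n <= f)%N -> (0 < m <= n)%N ->
  qs_expect f n m (fun k => k%:R) <= 4 * n%:R :> R.
Proof.
elim: f n m => [|f IH] n m nf mn /=; first by rewrite mulr_ge0.
have n0 : 0 < n%:R :> R by rewrite ltr0n; lia.
rewrite ler_pdivrMl//.
apply: (@le_trans _ _ (\sum_(j < n) (4 * (maxn j (n.-1 - j))%:R + n.-1%:R))).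
  apply: ler_sum => j _; have jn := ltn_ord j.
  have key p q : (p <= f)%N -> (0 < q <= p)%N -> (p <= maxn j (n.-1 - j))%N ->
      qs_expect f p q (fun k => (k + n.-1)%:R) <=
      4 * (maxn j (n.-1 - j))%:R + n.-1%:R :> R.
    move=> pf qp pj.
    have -> : (fun k : nat => (k + n.-1)%:R) =
        (fun k => 1 * k%:R + 1 * n.-1%:R) :> (nat -> R).
      by apply/funext => k; rewrite natrD !mul1r.
    rewrite (qs_expect_lin f p q 1 1 (fun k => k%:R) (fun=> n.-1%:R)).
    rewrite qs_expect_cst// !mul1r lerD2r (le_trans (IH _ _ pf qp))//.
    by rewrite ler_wpM2l// ler_nat.
  have [_|jm] := eqVneq; first by rewrite lerDr mulr_ge0.
  by case: ifPn => mj; apply: key; lia.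
rewrite big_split/= -mulr_sumr -natr_sum sumr_const card_ord.
rewrite -[_ *+ n]mulr_natl -!natrM -natrD ler_nat.
have := sum_maxn_le n; rewrite -!mulnn; set S := (\sum_(j < n) _)%N.
nia.
Qed.

(** * The recursion for the distance *)

Lemma ln_ge_oneBinv (R : realType) (x : R) : 0 < x -> 1 - x^-1 <= ln x.
Proof.
move=> x0; rewrite -[x in ln x]invrK lnV ?posrE ?invr_gt0//.
have : -1 < x^-1 - 1 by rewrite ltrBrDl subrr invr_gt0.
move=> /le_ln1Dx; rewrite addrC subrK; lra.
Qed.

(** This is what makes $c(1+\log(n/m))$ solve the recursion for the distance. From $k$ to $k+1$ the
    right side grows by $\log(k/m) + (k+1)\log((k+1)/k)$, and the last term is at least 1. *)
Lemma sum_ln_le (R : realType) (m n : nat) : (0 < m <= n)%N ->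
  \sum_(m <= j < n) (1 + ln (j%:R / m%:R)) <= n%:R * ln (n%:R / m%:R) :> R.
Proof.
case/andP=> m0 /subnKC <-; elim: (n - m)%N => [|d IH].
  by rewrite addn0 big_geq// divff ?pnatr_eq0 -?lt0n// ln1 mulr0.
rewrite addnS big_nat_recr ?leq_addr//=.
set k := (m + d)%N in IH *.
have k0 : 0 < k%:R :> R by rewrite ltr0n; lia.
have k10 : 0 < k.+1%:R :> R by rewrite ltr0n.
have m0' : 0 < m%:R :> R by rewrite ltr0n.
have lnE : ln (k.+1%:R / m%:R) = ln (k%:R / m%:R) + ln (k.+1%:R / k%:R) :> R.
  rewrite -lnM ?posrE ?divr_gt0//; congr ln.
  by field; rewrite !gt_eqF.
have := ln_ge_oneBinv (divr_gt0 k10 k0); rewrite invf_div => h.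
have : 1 <= k.+1%:R * ln (k.+1%:R / k%:R) :> R.
  apply: (@le_trans _ _ (k.+1%:R * (1 - k%:R / k.+1%:R))); last first.
    by rewrite ler_wpM2l// ltW.
  by rewrite mulrBr mulrCA mulfV ?gt_eqF// !mulr1 -natr1 addrAC subrr add0r.
rewrite lnE mulrDr -[in X in _ <= X + _]natr1 mulrDl mul1r; lra.
Qed.

Section distance_recursion.
Variables (R : realType) (mu : probability R R).
Hypothesis hmu : dickman_law mu.

(** The $n-1$ comparisons of the first round almost cancel the centring: $(k+n-1)/n - 1 = k/n -
    1/n$. *)
Lemma qs_expect_recl (f n m j : nat) (L : R) (h : R -> R) :
  (forall x y, `|h x - h y| <= L * `|x - y|) ->
  (j < n)%N -> (j <= f)%N -> (0 < m <= j)%N ->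
  `|qs_expect f j m (fun k => h ((k + n.-1)%:R / n%:R - 1))
    - qs_expect f j m (fun k => h (k%:R / n%:R))| <= L / n%:R.
Proof.
move=> Lh jn jf mj.
have n0 : 0 < n%:R :> R by rewrite ltr0n; lia.
have ni0 : 0 <= n%:R^-1 :> R by rewrite invr_ge0 ltW.
rewrite -(qs_expect_cst (L / n%:R) jf mj); apply: qs_expect_dist => k.
rewrite (le_trans (Lh _ _))//.
have -> : (k + n.-1)%:R / n%:R - 1 - k%:R / n%:R = - n%:R^-1 :> R.
  rewrite natrD -subn1 natrB; last by lia.
  by field; rewrite gt_eqF.
by rewrite normrN ger0_norm// invr_ge0 ltW.
Qed.

(** A crude bound for the pivots of rank below [m]: the argument of [h] is at most $(k+1)/n$ in
    absolute value, and the mean of $k+1$ is at most $4p+1 \le 5n$. *)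
Lemma qs_expect_short (f n m : nat) p q (L : R) (h : R -> R) :
  (forall x y, `|h x - h y| <= L * `|x - y|) ->
  (p < n)%N -> (p <= f)%N -> (0 < q <= p)%N ->
  `|qs_expect f p q (fun k => h ((k + n.-1)%:R / n%:R - 1)) - h 0| <= L * 5.
Proof.
move=> Lh pn pf qp; have L0 := lipschitz_cst_ge0 Lh.
have n0 : 0 < n%:R :> R by rewrite ltr0n; lia.
have ni0 : 0 <= n%:R^-1 :> R by rewrite invr_ge0 ltW.
rewrite -(qs_expect_cst (h 0) pf qp).
apply: (@le_trans _ _ (qs_expect f p q
    (fun k => (L / n%:R) * k%:R + (L / n%:R) * 1))).
  apply: qs_expect_dist => k; rewrite (le_trans (Lh _ _))//.
  rewrite -mulrDr -mulrA ler_wpM2l// (mulrC n%:R^-1).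
  have -> : (k + n.-1)%:R / n%:R - 1 - 0 = (k%:R - 1) / n%:R :> R.
    rewrite natrD -subn1 natrB; last by lia.
    by field; rewrite gt_eqF.
  rewrite normrM [X in _ * X]ger0_norm//.
  by rewrite ler_wpM2r// (le_trans (ler_normB _ _))// !ger0_norm.
rewrite (qs_expect_lin f p q _ _ (fun k => k%:R) (fun=> 1)) qs_expect_cst//.
rewrite -mulrDr -mulrA ler_wpM2l// ler_pdivrMl//.
apply: (@le_trans _ _ (4 * p%:R + 1)); first by rewrite lerD2r qs_expect_mean.
have : p.+1%:R <= n%:R :> R by rewrite ler_nat.
rewrite -natr1; have : 0 <= p%:R :> R by []. lra.
Qed.

Lemma dickman_scale_small (L u : R) (h : R -> R) :
  (forall x y, `|h x - h y| <= L * `|x - y|) -> 0 <= u <= 1 ->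
  `|h 0 - dickman_scale mu h u| <= 2 * L.
Proof.
move=> Lh /andP[u0 u1]; have L0 := lipschitz_cst_ge0 Lh.
have -> : h 0 = \int[mu]_x (cst (h 0) x).
  by rewrite Rintegral_cst// [X in fine X]probability_setT mulr1.
apply: (dickman_dist_Rintegral hmu).
- exact: finite_measure_integrable_cst.
- exact: (dickman_scale_integrable hmu u Lh).
- move=> x; rewrite (le_trans (Lh _ _))// ler_wpM2l// sub0r normrN normrM.
  rewrite ger0_norm// (le_trans (ler_piMl _ u1))//.
  by rewrite (le_trans (ler_normD _ _))// normr1.
Qed.

(** [L] and [h] vary in the induction, because the sublist of size $j$ is tested against $x \mapsto
    h((j/n)(x+1))$, of Lipschitz constant $Lj/n$. *)
Lemma qs_expect_dickman (f n m : nat) (L : R) (h : R -> R) :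
  (n <= f)%N -> (0 < m <= n)%N ->
  (forall x y, `|h x - h y| <= L * `|x - y|) ->
  `|qs_expect f n m (fun k => h (k%:R / n%:R - 1)) - \int[mu]_x h x|
    <= L * ((7 * m + 7)%:R * (1 + ln (n%:R / m%:R)) / n%:R).
Proof.
elim: f n L h => [|f IH] n L h nf mn Lh; first by lia.
have L0 := lipschitz_cst_ge0 Lh.
have n0 : 0 < n%:R :> R by rewrite ltr0n; lia.
have ni0 : 0 <= n%:R^-1 :> R by rewrite invr_ge0 ltW.
have n1 : 1 <= n%:R :> R by rewrite ler1n; lia.
pose c : R := (7 * m + 7)%:R.
(* Error for the pivot of rank $j+1$. If $j<m$ it is crude, $7 = 5+2$ from [qs_expect_short] and
   [dickman_scale_small]. Otherwise the factor $j/n$ cancels the $1/j$ of the induction hypothesis,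
   and the final 1 pays for the shift by $1/n$. *)
pose e j := if (j < m)%N then L * 7
  else L / n%:R * (c * (1 + ln (j%:R / m%:R)) + 1).
have step (j : 'I_n) :
  `|(if j.+1 == m then h (n.-1%:R / n%:R - 1)
     else if (m < j.+1)%N
     then qs_expect f j m (fun k => h ((k + n.-1)%:R / n%:R - 1))
     else qs_expect f (n - j.+1) (m - j.+1)
            (fun k => h ((k + n.-1)%:R / n%:R - 1)))
    - dickman_scale mu h (j%:R / n%:R)| <= e j.
  have jn := ltn_ord j.
  have jn1 : 0 <= (j%:R / n%:R : R) <= 1.
    by rewrite divr_ge0// ler_pdivrMr// mul1r ler_nat ltnW.
  have small x : `|x - h 0| <= L * 5 ->
      `|x - dickman_scale mu h (j%:R / n%:R)| <= L * 7.
    move=> hx; have := dickman_scale_small Lh jn1 => hs.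
    rewrite -[x in `|x - _|](subrK (h 0)) -addrA (le_trans (ler_normD _ _))//.
    by rewrite (le_trans (lerD hx hs))//; lra.
  rewrite /e; have [jm|jm] := eqVneq.
    rewrite -jm leqnn; apply: small; rewrite (le_trans (Lh _ _))// ler_wpM2l//.
    rewrite -subn1 natrB; last by lia.
    have -> : (n%:R - 1) / n%:R - 1 - 0 = - n%:R^-1 :> R by field; rewrite gt_eqF.
    rewrite normrN ger0_norm//.
    by rewrite (@le_trans _ _ 1)// ?invf_le1//; lra.
  case: ifPn => mj.
    have -> : (j < m)%N = false by lia.
    have j0 : 0 < j%:R :> R by rewrite ltr0n; lia.
    have jf : (j <= f)%N by lia.
    have mj' : (0 < m <= j)%N by lia.
    have h1 := qs_expect_recl Lh jn jf mj'.
    have := IH j _ _ jf mj' (lipschitz_scale (j%:R / n%:R) Lh).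
    rewrite -/(dickman_scale mu h (j%:R / n%:R)).
    (* The scaling identity $(j/n)(W_{j,m}+1) = C_{j,m}/n$. *)
    have -> : (fun k : nat => h (j%:R / n%:R * (k%:R / j%:R - 1 + 1))) =
        (fun k => h (k%:R / n%:R)).
      by apply/funext => k; congr h; field; rewrite !gt_eqF.
    rewrite -/c => h2.
    set X := qs_expect _ _ _ _ in h1 *.
    set Y := qs_expect _ _ _ _ in h1 h2.
    rewrite -[X in `|X - _|](subrK Y) -addrA (le_trans (ler_normD _ _))//.
    rewrite (le_trans (lerD h1 h2))// ger0_norm ?divr_ge0//.
    by rewrite le_eqVlt; apply/orP; left; apply/eqP; field; rewrite !gt_eqF.
  have -> : (j < m)%N by lia.
  by apply: small; apply: qs_expect_short => //; lia.
rewrite /=.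
set T := \sum_(j < n) _.
have h1 : `|n%:R^-1 * T - n%:R^-1 * \sum_(j < n) dickman_scale mu h (j%:R / n%:R)|
    <= n%:R^-1 * \sum_(j < n) e j.
  rewrite -mulrBr normrM ger0_norm//.
  rewrite ler_wpM2l// /T -sumrB.
  by rewrite (le_trans (ler_norm_sum _ _ _))//; apply: ler_sum => j _; exact: step.
have h2 : \sum_(j < n) e j <=
    L * (7 * m)%:R + L / n%:R * (c * (n%:R * ln (n%:R / m%:R)) + n%:R).
  rewrite -(big_mkord predT e) (big_cat_nat (n := m))//=; last by lia.
  apply: lerD.
    rewrite big_nat (eq_bigr (fun=> L * 7)) => [|j /andP[_ jm]]; last by rewrite /e jm.
    rewrite -big_nat sumr_const_nat subn0 -mulr_natr natrM; lra.
  rewrite big_nat (eq_bigr (fun j =>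
      L / n%:R * (c * (1 + ln (j%:R / m%:R)) + 1))) => [|j /andP[jm _]]; last first.
    by rewrite /e ltnNge jm.
  rewrite -big_nat -mulr_sumr ler_wpM2l ?divr_ge0// big_split/=.
  rewrite -mulr_sumr lerD// ?ler_wpM2l ?ler0n//; first exact: sum_ln_le.
  by rewrite sumr_const_nat ler_nat leq_subr.
have n0N : (0 < n)%N by lia.
have h3 := dickman_riemann_sum hmu Lh n0N.
rewrite distrC in h3.
set S := n%:R^-1 * \sum_(j < n) dickman_scale _ _ _ in h1 h3.
rewrite -[n%:R^-1 * T](subrK S) -addrA (le_trans (ler_normD _ _))//.
apply: (le_trans (lerD h1 h3)).
apply: (@le_trans _ _ (n%:R^-1 * (L * (7 * m)%:R +
   L / n%:R * (c * (n%:R * ln (n%:R / m%:R)) + n%:R)) + 6 * L / n%:R)).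
  by rewrite lerD2r ler_wpM2l.
(* The terms add up exactly: $7m$ from $j<m$, 1 from the shifts and 6 from the Riemann sum give the
   constant $7m+7$. *)
rewrite -/c /c natrD.
by rewrite le_eqVlt; apply/orP; left; apply/eqP; field; rewrite !gt_eqF.
Qed.

End distance_recursion.

Theorem theorem1p2 (R : realType) (mu : probability R R) (m n : nat) :
  dickman_law mu -> (2 <= m)%N -> (m <= n)%N ->
  (d1_qs_dickman n m mu <=
   (((46 * m + 8)%:R * ln (n%:R / m%:R) + (54 * m + 8)%:R) / n%:R)%:E)%E.
Proof.
move=> hmu m2 mn; apply: ge_ereal_sup => _ [h hLip <-]; rewrite lee_fin.
have Lh x y : `|h x - h y| <= 1 * `|x - y|.
  by rewrite mul1r distrC (distrC x); exact: hLip.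
have mn' : (0 < m <= n)%N by lia.
rewrite /qs_W_expect.
rewrite (qs_lawE (fun k => h (k%:R / n%:R - 1)) (leqnn n) mn' (leqnn _)).
rewrite (le_trans (qs_expect_dickman hmu (leqnn n) mn' Lh))// mul1r.
rewrite ler_wpM2r ?invr_ge0// mulrDr mulr1 addrC.
have ln0 : 0 <= ln (n%:R / m%:R) :> R.
  by apply: ln_ge0; rewrite ler_pdivlMr ?ltr0n ?mul1r ?ler_nat//; lia.
(* As the logarithm is non-negative, it suffices that $7m+7$ is at most $46m+8$ and $54m+8$. *)
by rewrite lerD// ?ler_wpM2r// ler_nat; lia.
Qed.
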